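(* Let $\mathfrak m$ be an uncountable cardinal with $\sup\{\mathfrak m^{\mathfrak n}:\mathfrak n<\mathfrak m\}=\mathfrak m$. If $G$ is a $P_{\mathfrak m}$-group of weight $\mathfrak m$, then $G$ is isomorphic to a topological subgroup of $\mathrm{Iso}(\mathbb U_{\mathfrak m})$.
   Context: A topological group $G$ is a $P_{\mathfrak m}$-group if the intersection of any family of fewer than $\mathfrak m$ open subsets of $G$ is open. $\mathbb U_{\mathfrak m}$ is the Urysohn–Katětov space of weight $\mathfrak m$: the complete metric space of density $\mathfrak m$ containing an isometric copy of every metric space of weight $\le\mathfrak m$ and $\mathfrak m$-homogeneous (every isometry between subsets of cardinality $<\mathfrak m$ extends to an isometry of the whole space); $\mathrm{Iso}(\mathbb U_{\mathfrak m})$ carries the topology of pointwise convergence.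
   Formalization: The topological group G is assumed to be Hausdorff, which the statement leaves implicit; this is necessary, since every topological subgroup of Iso(U_m) is Hausdorff. *)

(* Defs.v *)
From Stdlib Require Import Reals List.
Open Scope R_scope.

Definition card_le (A B : Type) : Prop :=
  exists f : A -> B, forall x y, f x = f y -> x = y.
Definition card_eq (A B : Type) : Prop :=
  exists f : A -> B, (forall x y, f x = f y -> x = y) /\ (forall y, exists x, f x = y).
Definition card_lt (A B : Type) : Prop := card_le A B /\ ~ card_le B A.

Definition uncountable (M : Type) : Prop := card_lt nat M.

(** sup { m^n : n < m } = m.  Since m^1 = m belongs to the family, this sup
    equals m iff every m^n (n < m) is <= m; m^n is the cardinality of N -> M. *)
Definition sup_pow_below_eq (M : Type) : Prop :=
  forall N : Type, card_lt N M -> card_le (N -> M) M.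

Definition is_topology {X : Type} (op : (X -> Prop) -> Prop) : Prop :=
  op (fun _ => True) /\
  (forall U V, op U -> op V -> op (fun x => U x /\ V x)) /\
  (forall (I : Type) (F : I -> X -> Prop),
      (forall i, op (F i)) -> op (fun x => exists i, F i x)).

Definition is_hausdorff {X : Type} (op : (X -> Prop) -> Prop) : Prop :=
  forall x y, x <> y -> exists U V, op U /\ op V /\ U x /\ V y /\
    (forall z, U z -> V z -> False).

Definition is_base {X : Type} (op : (X -> Prop) -> Prop) (I : Type) (B : I -> X -> Prop) : Prop :=
  (forall i, op (B i)) /\
  (forall U x, op U -> U x -> exists i, B i x /\ forall y, B i y -> U y).

Definition weight_is {X : Type} (op : (X -> Prop) -> Prop) (M : Type) : Prop :=
  (exists (I : Type) (B : I -> X -> Prop), is_base op I B /\ card_eq I M) /\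
  (forall (J : Type) (B : J -> X -> Prop), is_base op J B -> card_le M J).

Definition weight_le {X : Type} (op : (X -> Prop) -> Prop) (M : Type) : Prop :=
  exists (I : Type) (B : I -> X -> Prop), is_base op I B /\ card_le I M.

Definition is_group {G : Type} (mul : G -> G -> G) (inv : G -> G) (e : G) : Prop :=
  (forall x y z, mul x (mul y z) = mul (mul x y) z) /\
  (forall x, mul e x = x) /\ (forall x, mul x e = x) /\
  (forall x, mul (inv x) x = e) /\ (forall x, mul x (inv x) = e).

Definition is_topological_group {G : Type} (mul : G -> G -> G) (inv : G -> G) (e : G)
  (op : (G -> Prop) -> Prop) : Prop :=
  is_group mul inv e /\ is_topology op /\ is_hausdorff op /\
  (forall U x y, op U -> U (mul x y) ->
     exists V W, op V /\ op W /\ V x /\ W y /\ forall a b, V a -> W b -> U (mul a b)) /\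
  (forall U x, op U -> U (inv x) ->
     exists V, op V /\ V x /\ forall a, V a -> U (inv a)).

Definition is_P_space {G : Type} (op : (G -> Prop) -> Prop) (M : Type) : Prop :=
  forall (I : Type) (F : I -> G -> Prop), card_lt I M ->
    (forall i, op (F i)) -> op (fun x => forall i, F i x).

Definition is_metric {X : Type} (d : X -> X -> R) : Prop :=
  (forall x y, 0 <= d x y) /\ (forall x y, d x y = 0 <-> x = y) /\
  (forall x y, d x y = d y x) /\ (forall x y z, d x z <= d x y + d y z).

Definition metric_open {X : Type} (d : X -> X -> R) (U : X -> Prop) : Prop :=
  forall x, U x -> exists eps, 0 < eps /\ forall y, d x y < eps -> U y.

Definition metric_complete {X : Type} (d : X -> X -> R) : Prop :=
  forall u : nat -> X,
    (forall eps, 0 < eps -> exists N, forall m n, (N <= m)%nat -> (N <= n)%nat -> d (u m) (u n) < eps) ->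
    exists l, forall eps, 0 < eps -> exists N, forall n, (N <= n)%nat -> d (u n) l < eps.

Definition metric_dense {X : Type} (d : X -> X -> R) (D : X -> Prop) : Prop :=
  forall x eps, 0 < eps -> exists y, D y /\ d x y < eps.

Definition density_is {X : Type} (d : X -> X -> R) (M : Type) : Prop :=
  (exists D : X -> Prop, metric_dense d D /\ card_eq {x : X | D x} M) /\
  (forall D : X -> Prop, metric_dense d D -> card_le M {x : X | D x}).

Definition isometry_on {X : Type} (d : X -> X -> R) (A : X -> Prop) (f : X -> X) : Prop :=
  forall x y, A x -> A y -> d (f x) (f y) = d x y.

Definition is_isometry {X : Type} (d : X -> X -> R) (f : X -> X) : Prop :=
  (forall x y, d (f x) (f y) = d x y) /\ (forall y, exists x, f x = y).

Definition metric_universal {X : Type} (d : X -> X -> R) (M : Type) : Prop :=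
  forall (Y : Type) (dY : Y -> Y -> R), is_metric dY -> weight_le (metric_open dY) M ->
    exists f : Y -> X, forall a b, d (f a) (f b) = dY a b.

(** m-homogeneity: every isometry between subsets of cardinality < m
    (an isometric map f on A onto f(A)) extends to an isometry of X *)
Definition metric_homogeneous {X : Type} (d : X -> X -> R) (M : Type) : Prop :=
  forall (A : X -> Prop) (f : X -> X), card_lt {x : X | A x} M -> isometry_on d A f ->
    exists h, is_isometry d h /\ forall x, A x -> h x = f x.

Definition Urysohn_Katetov {X : Type} (d : X -> X -> R) (M : Type) : Prop :=
  is_metric d /\ metric_complete d /\ density_is d M /\
  metric_universal d M /\ metric_homogeneous d M.

(** topology of pointwise convergence on Iso(X): O (a set of maps, considered
    on isometries only) is open iff around each isometry f in O some basic
    neighbourhood {h | d (h x) (f x) < eps for x in a finite list} lies in O *)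
Definition iso_open {X : Type} (d : X -> X -> R) (O : (X -> X) -> Prop) : Prop :=
  forall f, is_isometry d f -> O f ->
    exists (l : list X) (eps : R), 0 < eps /\
      forall h, is_isometry d h -> (forall x, In x l -> d (h x) (f x) < eps) -> O h.

Definition embeds_into_Iso {G : Type} (mul : G -> G -> G) (op : (G -> Prop) -> Prop)
  {X : Type} (d : X -> X -> R) (phi : G -> X -> X) : Prop :=
  (forall g, is_isometry d (phi g)) /\
  (forall g h x, phi (mul g h) x = phi g (phi h x)) /\
  (forall g h, (forall x, phi g x = phi h x) -> g = h) /\
  (forall O, iso_open d O -> op (fun g => O (phi g))) /\
  (forall V, op V -> exists O, iso_open d O /\ forall g, V g <-> O (phi g)).

(* Main.v *)
Require Import Defs.
From Stdlib Require Import Reals List Lra Lia ZArith.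
From Stdlib Require Import Wellfounded Classical ClassicalEpsilon.
From Stdlib Require Import FunctionalExtensionality PropExtensionality.
From mathcomp Require eqtype boolp wochoice.

(** Since [M] is uncountable, a P_M-group has a base of open subgroups at the
    identity, and the union of their coset spaces is a G-set of at most [M] points
    with open stabilizers that determines the topology of G.  Over this discrete
    space one freely adjoins, as well-founded terms, a point for every Katětov
    function on fewer than [M] points; the distance is the infimum of the lengths
    of paths descending to subterms and ascending again.  G acts on terms by
    relabelling the leaves, and the stabilizer of a term is an intersection of
    fewer than [M] open sets, hence open.  The power hypothesis bounds the number
    of terms by [M], so a back-and-forth of length [M] identifies the pseudometric
    space of terms with the given Urysohn–Katětov space and transports the action. *)

(** * Cardinals *)

Lemma choice (A B : Type) (R : A -> B -> Prop) :
  (forall x, exists y, R x y) -> exists f, forall x, R x (f x).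
Proof.
  intros H; exists (fun x => proj1_sig (constructive_indefinite_description _ (H x))).
  intros x; apply proj2_sig.
Qed.

Lemma sig_eq (A : Type) (P : A -> Prop) (x y : {a | P a}) :
  proj1_sig x = proj1_sig y -> x = y.
Proof. apply eq_sig_hprop; intros; apply proof_irrelevance. Qed.

Lemma card_le_trans (A B C : Type) : card_le A B -> card_le B C -> card_le A C.
Proof.
  intros [f Hf] [g Hg]; exists (fun x => g (f x)); intros x y E.
  apply Hf, Hg, E.
Qed.

Lemma card_le_lt_trans (A B C : Type) : card_le A B -> card_lt B C -> card_lt A C.
Proof.
  intros HAB [HBC HCB]; split; [exact (card_le_trans A B C HAB HBC)|].
  intros HCA; exact (HCB (card_le_trans C A B HCA HAB)).
Qed.

Lemma card_le_fun (N A B : Type) : card_le A B -> card_le (N -> A) (N -> B).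
Proof.
  intros [f Hf]; exists (fun u n => f (u n)); intros u v E.
  apply functional_extensionality; intros n.
  apply Hf; exact (f_equal (fun w => w n) E).
Qed.

Lemma card_le_prod (A B C D : Type) :
  card_le A B -> card_le C D -> card_le (A * C) (B * D).
Proof.
  intros [f Hf] [g Hg]; exists (fun p => (f (fst p), g (snd p))).
  intros [a c] [a' c'] E; injection E as E1 E2; simpl in *.
  rewrite (Hf _ _ E1), (Hg _ _ E2); reflexivity.
Qed.

Lemma surj_of_card_le (A B : Type) (a0 : A) :
  card_le A B -> exists f : B -> A, forall a, exists b, f b = a.
Proof.
  intros [g Hg].
  assert (H : forall b, exists a, forall a', g a' = b -> a' = a).
  { intros b; destruct (classic (exists a', g a' = b)) as [[a' E]|N].
    - exists a'; intros a'' E'; apply Hg; congruence.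
    - exists a0; intros a' E; exfalso; apply N; exists a'; exact E. }
  destruct (choice _ _ _ H) as [f Hf]; exists f.
  intros a; exists (g a); symmetry; apply Hf; reflexivity.
Qed.

Section Large.

Variable M : Type.
Hypotheses (Hunc : uncountable M) (Hpow : sup_pow_below_eq M).

Lemma uncountable_two : exists a b : M, a <> b.
Proof.
  destruct Hunc as [[f Hf] _]; exists (f 0%nat), (f 1%nat); intros E.
  discriminate (Hf _ _ E).
Qed.

Lemma card_le_square : card_le (M * M) M.
Proof.
  apply card_le_trans with (bool -> M).
  - exists (fun p b => if b : bool then fst p else snd p).
    intros [x y] [x' y'] E.
    pose proof (f_equal (fun w => w true) E) as E1.
    pose proof (f_equal (fun w => w false) E) as E2.
    simpl in E1, E2; congruence.
  - apply Hpow, card_le_lt_trans with nat; [|exact Hunc].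
    exists (fun b => if b : bool then 1%nat else 0%nat).
    intros [|] [|] E; congruence.
Qed.

Lemma card_le_prod_M (A B : Type) : card_le A M -> card_le B M -> card_le (A * B) M.
Proof.
  intros HA HB; exact (card_le_trans _ _ _ (card_le_prod _ _ _ _ HA HB) card_le_square).
Qed.

Lemma card_le_sum_M (A B : Type) : card_le A M -> card_le B M -> card_le (A + B) M.
Proof.
  intros [f Hf] [g Hg]; destruct uncountable_two as [m0 [m1 Hm]].
  apply card_le_trans with (M * M)%type; [|exact card_le_square].
  exists (fun s => match s with inl a => (m0, f a) | inr b => (m1, g b) end).
  intros [a|b] [a'|b'] E; pose proof (f_equal fst E) as E1;
    pose proof (f_equal snd E) as E2; simpl in E1, E2.
  - rewrite (Hf _ _ E2); reflexivity.
  - contradiction.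
  - symmetry in E1; contradiction.
  - rewrite (Hg _ _ E2); reflexivity.
Qed.

Lemma card_le_option_M (A : Type) : card_le A M -> card_le (option A) M.
Proof.
  intros HA; destruct uncountable_two as [m0 _].
  apply card_le_trans with (A + unit)%type.
  - exists (fun o => match o with Some a => inl a | None => inr tt end).
    intros [a|] [b|] E; congruence.
  - apply card_le_sum_M; [exact HA|].
    exists (fun _ => m0); intros [] [] _; reflexivity.
Qed.

(** An injection of [option M] into [option A] takes the value [None] at most once. Where it does so
    at a point of [M], the image of the spare point [None] is used instead, and [M] would inject
    into [A]. *)
Lemma card_lt_option (A : Type) : card_lt A M -> card_lt (option A) M.
Proof.
  intros [HA HN]; split; [exact (card_le_option_M A HA)|].
  intros [f Hf]; apply HN.
  destruct (card_le_option_M M) as [s Hs]; [exists (fun x => x); auto|].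
  set (F := fun o => f (s o)).
  assert (HF : forall x y, F x = F y -> x = y) by (intros x y E; apply Hs, Hf, E).
  assert (H : forall m, exists a,
    F (Some m) = Some a \/ (F (Some m) = None /\ F None = Some a)).
  { intros m; destruct (F (Some m)) as [a|] eqn:E1; [exists a; auto|].
    destruct (F None) as [a|] eqn:E2; [exists a; auto|].
    rewrite <- E2 in E1; discriminate (HF _ _ E1). }
  destruct (choice _ _ _ H) as [g Hg]; exists g; intros x y E.
  assert (K : F (Some x) = F (Some y) -> x = y).
  { intros E'; pose proof (HF _ _ E') as E2; congruence. }
  assert (K2 : forall z, F (Some z) <> F None).
  { intros z E'; discriminate (HF _ _ E'). }
  destruct (Hg x) as [Hx|[Hx Hx']], (Hg y) as [Hy|[Hy Hy']]; rewrite E in *.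
  - apply K; congruence.
  - destruct (K2 x); congruence.
  - destruct (K2 y); congruence.
  - apply K; congruence.
Qed.

Lemma card_le_nat_fun (A : Type) : card_le A M -> card_le (nat -> A) M.
Proof.
  intros HA; apply card_le_trans with (nat -> M);
    [exact (card_le_fun _ _ _ HA) | exact (Hpow nat Hunc)].
Qed.

Lemma card_le_Z_nat : card_le Z nat.
Proof.
  exists (fun z => if Z_lt_dec z 0 then (2 * Z.abs_nat z + 1)%nat else (2 * Z.abs_nat z)%nat).
  intros x y; destruct (Z_lt_dec x 0), (Z_lt_dec y 0); lia.
Qed.

(** Reals with the same [up] differ by less than 1, while multiplication by a large [n] stretches
    any gap beyond 1. *)
Lemma up_scaled_eq (x y : R) : (forall n, up (x * INR n) = up (y * INR n)) -> ~ x < y.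
Proof.
  intros E H.
  destruct (INR_unbounded (/ (y - x))) as [n Hn].
  specialize (E n).
  destruct (archimed (x * INR n)) as [A1 A2], (archimed (y * INR n)) as [B1 B2].
  rewrite E in A1, A2.
  assert (K : 1 < (y - x) * INR n).
  { rewrite <- (Rinv_r (y - x)) by lra; apply Rmult_lt_compat_l; lra. }
  lra.
Qed.

Lemma card_le_R : card_le R M.
Proof.
  apply card_le_trans with (nat -> Z).
  - exists (fun x n => up (x * INR n)); intros x y E.
    pose proof (fun n => f_equal (fun w => w n) E) as E'; cbv beta in E'.
    destruct (Rtotal_order x y) as [L|[L|L]]; [|exact L|].
    + destruct (up_scaled_eq x y E' L).
    + destruct (up_scaled_eq y x (fun n => eq_sym (E' n)) L).
  - apply card_le_nat_fun, card_le_trans with nat;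
      [exact card_le_Z_nat | exact (proj1 Hunc)].
Qed.

End Large.

(** * Well-orders with small initial segments *)

Lemma well_order_exists (M : Type) : exists lt : M -> M -> Prop,
  well_founded lt /\ (forall a b, lt a b \/ a = b \/ lt b a).
Proof.
  destruct (wochoice.well_ordering_principle (eqtype.Equality.Pack (eqtype.Equality.Class (boolp.gen_eqMixin M)))) as [r Hr].
  assert (Hmin : forall P : M -> Prop, (exists x, P x) ->
    exists z, P z /\ forall x, P x -> r z x = true).
  { intros P [x Px].
    set (A := fun x : M => if excluded_middle_informative (P x) then true else false).
    assert (HA : forall x, A x = true <-> P x).
    { intros y; unfold A; destruct (excluded_middle_informative (P y)); split; auto; discriminate. }
    destruct (Hr A) as [z [[Hz Hl] _]]; [exists x; apply HA; exact Px|].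
    exists z; split; [apply HA; exact Hz|].
    intros y Py; apply Hl; apply HA; exact Py. }
  (* Antisymmetry: both [x] and [y] would be least in the pair {x, y}, whose least element is
     unique. *)
  assert (Huniq : forall x y, r x y = true -> r y x = true -> x = y).
  { intros x y Hxy Hyx.
    set (A := fun z : M => if excluded_middle_informative (z = x \/ z = y) then true else false).
    assert (HA : forall z, A z = true <-> z = x \/ z = y).
    { intros z; unfold A; destruct (excluded_middle_informative (z = x \/ z = y)); split; auto; discriminate. }
    assert (Hrefl : forall z, r z z = true).
    { intros z; destruct (Hmin (eq z)) as [w [<- Hw]]; [exists z; reflexivity|].
      apply Hw; reflexivity. }
    destruct (Hr A) as [z [_ Hz]]; [exists x; apply HA; auto|].
    transitivity z; [symmetry|]; apply Hz; split;
      try (apply HA; auto); intros w Hw; apply HA in Hw;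
      destruct Hw as [-> | ->]; auto. }
  exists (fun a b => r a b = true /\ a <> b); split.
  - intros a; apply NNPP; intros Na.
    destruct (Hmin (fun a => ~ Acc (fun a b => r a b = true /\ a <> b) a)) as [z [Hz Hl]];
      [exists a; exact Na|].
    apply Hz; constructor; intros y [Hy Hne]; apply NNPP; intros Ny.
    apply Hne, Huniq; [exact Hy | exact (Hl y Ny)].
  - intros a b; destruct (classic (a = b)) as [E|N]; [auto|].
    destruct (Hmin (fun x => x = a \/ x = b)) as [z [[-> | ->] Hl]]; [exists a; auto| |].
    + left; split; auto.
    + right; right; split; auto.
Qed.

(* If some initial segment is already as large as [M], the order of the least
   such segment is pulled back to [M]. *)
Lemma initial_order_exists (M : Type) : exists lt : M -> M -> Prop,
  well_founded lt /\ (forall a b, lt a b \/ a = b \/ lt b a) /\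
  (forall a, card_lt {b | lt b a} M).
Proof.
  destruct (well_order_exists M) as [lt [Hwf Htot]].
  assert (Hle : forall (r : M -> M -> Prop) a, card_le {b | r b a} M).
  { intros r a; exists (@proj1_sig _ _); intros x y E; apply sig_eq, E. }
  destruct (classic (exists a, card_le M {b | lt b a})) as [Hex|Hno].
  - assert (Hleast : exists a, card_le M {b | lt b a} /\
      forall c, lt c a -> ~ card_le M {b | lt b c}).
    { destruct Hex as [a Ha]; revert Ha.
      induction a as [a IH] using (well_founded_ind Hwf); intros Ha.
      destruct (classic (exists c, lt c a /\ card_le M {b | lt b c})) as [[c [Hc Hc']]|N].
      - exact (IH c Hc Hc').
      - exists a; split; [exact Ha|]; intros c Hc Hc'; apply N; exists c; auto. }
    destruct Hleast as [a [[j Hj] Hmin]].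
    exists (fun x y => lt (proj1_sig (j x)) (proj1_sig (j y))); split; [|split].
    + apply (wf_inverse_image _ _ lt (fun x => proj1_sig (j x))), Hwf.
    + intros x y; destruct (Htot (proj1_sig (j x)) (proj1_sig (j y))) as [H|[H|H]]; auto.
      right; left; apply Hj, sig_eq, H.
    + intros x; split; [apply (Hle (fun x y => lt (proj1_sig (j x)) (proj1_sig (j y))))|].
      (* [j] carries the new segment below [x] into the old segment below [j x], which is too small
         by the minimality of [a]. *)
      intros H; apply (Hmin (proj1_sig (j x)) (proj2_sig (j x))).
      apply (card_le_trans _ _ _ H).
      exists (fun b => exist (fun z => lt z (proj1_sig (j x))) (proj1_sig (j (proj1_sig b))) (proj2_sig b)).
      intros b c E; apply (f_equal (@proj1_sig _ _)) in E.
      apply sig_eq, Hj, sig_eq, E.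
  - exists lt; split; [exact Hwf|split; [exact Htot|]].
    intros a; split; [apply Hle|]; intros H; apply Hno; exists a; exact H.
Qed.

(** * Katětov terms *)

Lemma glb_exists (E : R -> Prop) (b : R) :
  (exists r, E r) -> (forall r, E r -> b <= r) ->
  exists m, (forall r, E r -> m <= r) /\ (forall c, (forall r, E r -> c <= r) -> c <= m).
Proof.
  intros [r0 H0] Hb.
  destruct (completeness (fun x => E (- x))) as [m [Hub Hlub]].
  - exists (- b); intros x Hx; specialize (Hb _ Hx); lra.
  - exists (- r0); rewrite Ropp_involutive; exact H0.
  - exists (- m); split.
    + intros r Hr; assert (- r <= m) by (apply Hub; rewrite Ropp_involutive; exact Hr); lra.
    + intros c Hc; assert (m <= - c); [|lra].
      apply Hlub; intros x Hx; specialize (Hc _ Hx); lra.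
Qed.

Section Terms.

Variables (M : Type) (Ar : M -> Type) (Y : Type).
Hypothesis Ar_inh : forall a, inhabited (Ar a).

(* [node a A f] names a point at distance [Rabs (f i)] from each [A i]; the
   absolute value keeps path lengths nonnegative for ill-formed [f]. *)
Inductive term : Type :=
| leaf (y : Y)
| node (a : M) (A : Ar a -> term) (f : Ar a -> R).

(** The number is the total length of a chain of edges leading down to a subterm; several chains, of
    different lengths, may reach the same subterm. *)
Inductive desc : term -> term -> R -> Prop :=
| desc_refl t : desc t t 0
| desc_step a A f i u r : desc (A i) u r -> desc (node a A f) u (Rabs (f i) + r).

(* The lengths of the paths that first descend from [p] and then ascend to [q];
   distinct leaves are joined by an edge of length 1. *)
Definition path (p q : term) (r : R) : Prop :=
  exists u v r1 r2, desc p u r1 /\ desc q v r2 /\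
    ((u = v /\ r = r1 + r2) \/
     (exists y z, u = leaf y /\ v = leaf z /\ r = r1 + 1 + r2)).

(** The infimum of the path lengths. It is defined for all terms because [valid] is itself stated
    through it. *)
Definition kdist (p q : term) : R :=
  epsilon (inhabits 0) (fun m => (forall r, path p q r -> m <= r) /\
    (forall c, (forall r, path p q r -> c <= r) -> c <= m)).

(** Hereditarily, the absolute values of the labels form a Katětov function on the children. *)
Fixpoint valid (t : term) : Prop :=
  match t with
  | leaf _ => True
  | node a A f => (forall i, valid (A i)) /\
      (forall i j, Rabs (f i) <= Rabs (f j) + kdist (A i) (A j) /\
                   kdist (A i) (A j) <= Rabs (f i) + Rabs (f j))
  end.

Lemma desc_nonneg p u r : desc p u r -> 0 <= r.
Proof.
  induction 1 as [|a A f i u r _ IH]; [lra|].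
  pose proof (Rabs_pos (f i)); lra.
Qed.

Lemma desc_trans p u v r s : desc p u r -> desc u v s -> desc p v (r + s).
Proof.
  intros H1 H2; induction H1 as [|a A f i u r _ IH].
  - rewrite Rplus_0_l; exact H2.
  - rewrite Rplus_assoc; constructor; auto.
Qed.

(** Arities are inhabited, so a descent can always be continued to a leaf. Hence any two terms are
    joined by a path, and the infimum [kdist] exists. *)
Lemma desc_leaf p : exists y r, desc p (leaf y) r.
Proof.
  induction p as [y|a A IH f]; [exists y, 0; constructor|].
  destruct (Ar_inh a) as [i]; destruct (IH i) as [y [r H]].
  exists y, (Rabs (f i) + r); constructor; exact H.
Qed.

Lemma path_nonneg p q r : path p q r -> 0 <= r.
Proof.
  intros (u & v & r1 & r2 & H1 & H2 & H); apply desc_nonneg in H1, H2.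
  destruct H as [[_ ->]|(y & z & _ & _ & ->)]; lra.
Qed.

Lemma path_sym p q r : path p q r -> path q p r.
Proof.
  intros (u & v & r1 & r2 & H1 & H2 & H); exists v, u, r2, r1.
  split; [exact H2|split; [exact H1|]].
  destruct H as [[-> ->]|(y & z & -> & -> & ->)].
  - left; split; [reflexivity|lra].
  - right; exists z, y; repeat split; lra.
Qed.

Lemma kdist_glb p q : (forall r, path p q r -> kdist p q <= r) /\
  (forall c, (forall r, path p q r -> c <= r) -> c <= kdist p q).
Proof.
  unfold kdist; apply epsilon_spec, glb_exists with 0; [|apply path_nonneg].
  destruct (desc_leaf p) as (y & r & H1), (desc_leaf q) as (z & s & H2).
  exists (r + 1 + s), (leaf y), (leaf z), r, s.
  split; [exact H1|split; [exact H2|right; exists y, z; auto]].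
Qed.

Lemma kdist_le p q r : path p q r -> kdist p q <= r.
Proof. apply kdist_glb. Qed.

Lemma kdist_ge p q c : (forall r, path p q r -> c <= r) -> c <= kdist p q.
Proof. apply kdist_glb. Qed.

Lemma kdist_sym p q : kdist p q = kdist q p.
Proof.
  apply Rle_antisym; apply kdist_ge; intros r H; apply kdist_le, path_sym, H.
Qed.

(** A descent put in front of a path gives a path again, so this case of the triangle inequality
    holds for all terms. *)
Lemma kdist_desc p u q r : desc p u r -> kdist p q <= r + kdist u q.
Proof.
  intros H; assert (kdist p q - r <= kdist u q); [|lra].
  apply kdist_ge; intros s (u' & v & r1 & r2 & H1 & H2 & K).
  assert (kdist p q <= r + s); [|lra]; apply kdist_le.
  exists u', v, (r + r1), r2; split; [exact (desc_trans _ _ _ _ _ H H1)|split; [exact H2|]].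
  destruct K as [[-> ->]|(y & z & -> & -> & ->)].
  - left; split; [reflexivity|lra].
  - right; exists y, z; repeat split; lra.
Qed.

Lemma path_refl p : path p p 0.
Proof.
  exists p, p, 0, 0; repeat split; try constructor; split; [reflexivity|lra].
Qed.

Lemma kdist_refl p : kdist p p = 0.
Proof.
  apply Rle_antisym; [apply kdist_le, path_refl|apply kdist_ge, path_nonneg].
Qed.

(** Splits off the last edge, for inductions on [q]. If the ascent to [q] is empty, the path is a
    descent or stops after the unit edge; otherwise it enters [q] from a child. *)
Lemma path_end p q r : path p q r ->
  desc p q r \/
  match q with
  | leaf _ => exists y s, desc p (leaf y) s /\ r = s + 1
  | node a B g => exists j s, path p (B j) s /\ r = s + Rabs (g j)
  end.
Proof.
  intros (u & v & r1 & r2 & H1 & H2 & H).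
  destruct H2 as [t|a B g j v r2 H2].
  - destruct H as [[-> ->]|(y & z & -> & -> & ->)].
    + left; rewrite Rplus_0_r; exact H1.
    + right; exists y, r1; rewrite Rplus_0_r; auto.
  - right; destruct H as [[-> ->]|(y & z & -> & -> & ->)].
    + exists j, (r1 + r2); split; [|lra].
      exists v, v, r1, r2; auto.
    + exists j, (r1 + 1 + r2); split; [|lra].
      exists (leaf y), (leaf z), r1, r2; split; [exact H1|split; [exact H2|]].
      right; exists y, z; auto.
Qed.

Lemma kdist_add_ge p s q c :
  (forall r1 r2, path p s r1 -> path q s r2 -> c <= r1 + r2) -> c <= kdist p s + kdist s q.
Proof.
  intros K; rewrite (kdist_sym s q).
  assert (c - kdist q s <= kdist p s); [|lra]; apply kdist_ge; intros r1 H1.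
  assert (c - r1 <= kdist q s); [|lra]; apply kdist_ge; intros r2 H2.
  specialize (K r1 r2 H1 H2); lra.
Qed.

(* A peak [B j - s - B k] of a concatenated path is cut off at cost
   [kdist (B j) (B k)], which validity of [s] bounds by the length of the peak. *)
Lemma kdist_triangle p s q : valid s -> kdist p q <= kdist p s + kdist s q.
Proof.
  revert p q; induction s as [y0|a B IH g]; intros p q Vs;
    apply kdist_add_ge; intros r1 r2 H1 H2;
    (* If one of the two paths merely descends to [s], then [kdist_desc] suffices. *)
    (destruct (path_end _ _ _ H1) as [K1|K1];
      [pose proof (kdist_desc _ _ q _ K1); apply path_sym, kdist_le in H2; lra|]);
    (destruct (path_end _ _ _ H2) as [K2|K2];
      [pose proof (kdist_desc _ _ p _ K2); rewrite kdist_sym; apply path_sym, kdist_le in H1; lra|]).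
  (* Both paths reach the leaf [s] by a unit edge; a single unit edge bypasses it. *)
  - destruct K1 as (y & s1 & K1 & ->), K2 as (z & s2 & K2 & ->).
    assert (kdist p q <= s1 + 1 + s2); [|lra]; apply kdist_le.
    exists (leaf y), (leaf z), s1, s2; split; [exact K1|split; [exact K2|]].
    right; exists y, z; auto.
  - destruct K1 as (j & s1 & K1 & ->), K2 as (k & s2 & K2 & ->).
    destruct Vs as [VB Vg].
    pose proof (IH j p q (VB j)).
    pose proof (IH k (B j) q (VB k)).
    destruct (Vg j k) as [_ Vjk].
    apply kdist_le in K1; apply path_sym, kdist_le in K2; lra.
Qed.

(** A descent from a child [A i] to [t], prolonged by the edge from [t] to [A i], would lead to
    [A i] from one of its own children, which the induction hypothesis for [A i] excludes. *)
Lemma no_desc_from_child t : match t with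
  | leaf _ => True
  | node a A f => forall i r, ~ desc (A i) t r
  end.
Proof.
  induction t as [y|a A IH f]; [exact I|]; intros i r H.
  specialize (IH i).
  remember (A i) as c eqn:Ec; remember (node a A f) as t eqn:Et.
  destruct H as [t|a' A' f' j u s H'].
  - rewrite Et in IH; apply (IH i 0); rewrite <- Ec, Et; constructor.
  - apply (IH j (s + (Rabs (f i) + 0))).
    apply (desc_trans _ _ _ _ _ H'); rewrite Et; constructor; rewrite <- Ec; constructor.
Qed.

(** The new point realizes its Katětov function: any path up to the node enters through some child
    [A j], and the Lipschitz inequality shows that this is no shortcut. *)
Lemma kdist_node a A f i : valid (node a A f) -> kdist (A i) (node a A f) = Rabs (f i).
Proof.
  intros [_ V]; apply Rle_antisym.
  - apply kdist_le; exists (A i), (A i), 0, (Rabs (f i) + 0).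
    split; [constructor|split; [repeat constructor|left; split; [reflexivity|lra]]].
  - apply kdist_ge; intros r H; destruct (path_end _ _ _ H) as [K|(j & s & K & ->)].
    + destruct (no_desc_from_child (node a A f) i r K).
    + apply kdist_le in K; destruct (V i j) as [Vij _]; lra.
Qed.

(** Nothing lies below a leaf, so every path between distinct leaves contains the unit edge. *)
Lemma kdist_leaf_lt_1 y z : kdist (leaf y) (leaf z) < 1 -> y = z.
Proof.
  intros H; apply NNPP; intros N.
  assert (1 <= kdist (leaf y) (leaf z)); [|lra]; apply kdist_ge.
  intros r (u & v & r1 & r2 & H1 & H2 & K).
  apply desc_nonneg in H1 as P1; apply desc_nonneg in H2 as P2.
  destruct K as [[E ->]|(y' & z' & _ & _ & ->)]; [|lra].
  inversion H1; inversion H2; subst; congruence.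
Qed.

(** * Relabelling the leaves *)

Fixpoint tmap (k : Y -> Y) (t : term) : term :=
  match t with
  | leaf y => leaf (k y)
  | node a A f => node a (fun i => tmap k (A i)) f
  end.

Lemma tmap_id k t : (forall y, k y = y) -> tmap k t = t.
Proof.
  intros Hk; induction t as [y|a A IH f]; simpl; [rewrite Hk; reflexivity|].
  f_equal; apply functional_extensionality; exact IH.
Qed.

Lemma tmap_comp k l m t : (forall y, k y = l (m y)) -> tmap k t = tmap l (tmap m t).
Proof.
  intros Hk; induction t as [y|a A IH f]; simpl; [rewrite Hk; reflexivity|].
  f_equal; apply functional_extensionality; exact IH.
Qed.

Lemma desc_tmap k p u r : desc p u r -> desc (tmap k p) (tmap k u) r.
Proof.
  induction 1 as [|a A f i u r _ IH]; [constructor|].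
  exact (desc_step a (fun i => tmap k (A i)) f i _ r IH).
Qed.

(** The unit edge in [path] joins any two leaves, equal or not, so paths keep their lengths even
    when [k] identifies leaves. *)
Lemma kdist_tmap_le k p q : kdist (tmap k p) (tmap k q) <= kdist p q.
Proof.
  apply kdist_ge; intros r (u & v & r1 & r2 & H1 & H2 & K); apply kdist_le.
  exists (tmap k u), (tmap k v), r1, r2.
  split; [exact (desc_tmap _ _ _ _ H1)|split; [exact (desc_tmap _ _ _ _ H2)|]].
  destruct K as [[-> ->]|(y & z & -> & -> & ->)]; [left; auto|].
  right; exists (k y), (k z); auto.
Qed.

Lemma kdist_tmap k l p q : (forall y, l (k y) = y) -> kdist (tmap k p) (tmap k q) = kdist p q.
Proof.
  intros H; apply Rle_antisym; [apply kdist_tmap_le|].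
  assert (E : forall t, tmap l (tmap k t) = t).
  { intros t; rewrite <- (tmap_comp (fun y => l (k y))); [apply tmap_id|]; auto. }
  rewrite <- (E p) at 1; rewrite <- (E q) at 1; apply kdist_tmap_le.
Qed.

Lemma valid_tmap k l t : (forall y, l (k y) = y) -> valid t -> valid (tmap k t).
Proof.
  intros H; induction t as [y|a A IH f]; simpl; [trivial|].
  intros [V1 V2]; split; [auto|]; intros i j.
  rewrite (kdist_tmap k l _ _ H); apply V2.
Qed.

(* Injectivity of the coding is by recursion on terms, since [M] itself absorbs
   one application of the functor defining [term]. *)
Lemma term_card : uncountable M -> sup_pow_below_eq M ->
  (forall a, card_lt (Ar a) M) -> card_le Y M -> card_le term M.
Proof.
  intros Hunc Hpow HAr HY.
  assert (Hk : forall a, {k : (Ar a -> M) -> M | forall u v, k u = k v -> u = v}).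
  { intros a; apply constructive_indefinite_description; exact (Hpow _ (HAr a)). }
  destruct (card_le_R M Hunc Hpow) as [rho Hrho].
  assert (HS : card_le (Y + M * (M * M)) M).
  { apply card_le_sum_M; auto.
    assert (card_le M M) by (exists (fun x => x); auto).
    repeat (apply card_le_prod_M; auto). }
  destruct HS as [j Hj].
  set (code := fix code t := match t with
    | leaf y => j (inl y)
    | node a A f => j (inr (a, (proj1_sig (Hk a) (fun i => code (A i)),
                                proj1_sig (Hk a) (fun i => rho (f i)))))
    end).
  exists code; induction x as [y|a A IH f]; intros [z|b B g] E; apply Hj in E;
    try discriminate E.
  - congruence.
  - injection E as -> E1 E2.
    apply (proj2_sig (Hk b)) in E1, E2.
    assert (A = B) as ->.
    { apply functional_extensionality; intros i; apply IH.
      exact (f_equal (fun w => w i) E1). }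
    assert (f = g) as ->; [|reflexivity].
    apply functional_extensionality; intros i; apply Hrho.
    exact (f_equal (fun w => w i) E2).
Qed.

End Terms.

Arguments leaf {M Ar Y} y.
Arguments node {M Ar Y} a A f.
Arguments kdist {M Ar Y} p q.
Arguments valid {M Ar Y} t.
Arguments tmap {M Ar Y} k t.

(** * Urysohn–Katětov spaces *)

Lemma inv_INR_lt (eps : R) : 0 < eps -> exists n, 0 < / INR (S n) < eps.
Proof.
  intros H; destruct (archimed_cor1 eps H) as [[|n] [H1 H2]]; [lia|].
  exists n; split; [apply Rinv_0_lt_compat, lt_0_INR; lia | exact H1].
Qed.

Lemma metric_weight_le (Y M : Type) (d : Y -> Y -> R) :
  is_metric d -> card_le (Y * nat) M -> weight_le (metric_open d) M.
Proof.
  intros (_ & H0 & Hs & Ht) HM.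
  exists (Y * nat)%type, (fun p y => d (fst p) y < / INR (S (snd p))).
  split; [split|exact HM].
  - intros [c n] x Hx; cbn [fst snd] in *; exists (/ INR (S n) - d c x); split; [lra|].
    intros y Hy; pose proof (Ht c x y); lra.
  - intros U x HU Ux; destruct (HU x Ux) as [eps [He HB]].
    destruct (inv_INR_lt eps He) as [n Hn]; exists (x, n); cbn [fst snd]; split.
    + rewrite (proj2 (H0 x x) eq_refl); lra.
    + intros y Hy; apply HB; lra.
Qed.

(** A point is determined by a sequence in [D] converging to it. The bound lets the back-and-forth
    run through all of the space rather than a dense subset. *)
Lemma dense_card (X M : Type) (d : X -> X -> R) (D : X -> Prop) :
  uncountable M -> sup_pow_below_eq M -> is_metric d ->
  metric_dense d D -> card_le {x | D x} M -> card_le X M.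
Proof.
  intros Hunc Hpow (Hp & H0 & Hs & Ht) HD HM.
  apply card_le_trans with (nat -> {x | D x}); [|apply card_le_nat_fun; assumption].
  assert (H : forall x, exists u : nat -> {x | D x}, forall n, d x (proj1_sig (u n)) < / INR (S n)).
  { intros x; apply (choice _ _ (fun n (y : {x | D x}) => d x (proj1_sig y) < / INR (S n))); intros n.
    destruct (HD x (/ INR (S n))) as [y [Dy Hy]];
      [apply Rinv_0_lt_compat, lt_0_INR; lia|].
    exists (exist _ y Dy); exact Hy. }
  destruct (choice _ _ _ H) as [u Hu]; exists u; intros x y E.
  apply H0, Rle_antisym; [|apply Hp]; apply Rnot_lt_le; intros L.
  destruct (inv_INR_lt (d x y / 2)) as [n Hn]; [lra|].
  pose proof (Hu x n); pose proof (Hu y n) as Hy; rewrite <- E, Hs in Hy.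
  pose proof (Ht x (proj1_sig (u x n)) y); lra.
Qed.

(** Universality embeds the abstract one-point extension of the family; homogeneity gives an
    isometry [h] carrying the family onto its embedded copy, and the preimage under [h] of the extra
    point is as required. *)
Lemma one_point_extension (X M : Type) (d : X -> X -> R) :
  uncountable M -> sup_pow_below_eq M -> is_metric d ->
  metric_universal d M -> metric_homogeneous d M ->
  forall (J : Type) (x : J -> X) (f : J -> R), card_lt J M ->
  (forall i j, f i <= f j + d (x i) (x j)) ->
  (forall i j, d (x i) (x j) <= f i + f j) ->
  exists x', forall i, d (x i) x' = f i.
Proof.
  intros Hunc Hpow Hd Huniv Hhom J x f HJ Hlip Hadd.
  pose proof Hd as (Hp & H0 & Hs & Ht).
  assert (Hf : forall i, 0 <= f i).
  { intros i; pose proof (Hadd i i); pose proof (Hp (x i) (x i)); lra. }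
  (* At a zero of [f] the adjoined point would coincide with an old one, so that old point is the
     answer. *)
  destruct (classic (exists i, f i = 0)) as [[i Hi]|Hpos].
  { exists (x i); intros j; pose proof (Hlip j i); pose proof (Hadd j i); lra. }
  (* The family may have repetitions, so the extension is built over its range, with [idx] choosing
     an index for each point. *)
  set (S := {y | exists i, x i = y}).
  destruct (choice _ _ (fun (p : S) i => x i = proj1_sig p) (fun p => proj2_sig p)) as [idx Hidx].
  assert (HS : card_le S J).
  { exists idx; intros p q E; apply sig_eq; rewrite <- !Hidx, E; reflexivity. }
  set (dS := fun p q : option S => match p, q with
    | None, None => 0
    | Some p, None => f (idx p)
    | None, Some q => f (idx q)
    | Some p, Some q => d (proj1_sig p) (proj1_sig q)
    end).
  assert (HdS : is_metric dS).
  { repeat split; unfold dS.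
    - intros [p|] [q|]; auto; lra.
    - destruct x0 as [p|], y as [q|]; intros E; try (destruct Hpos; eauto; fail); auto.
      f_equal; apply sig_eq, H0, E.
    - intros <-; destruct x0 as [p|]; [apply H0|]; reflexivity.
    - intros [p|] [q|]; auto.
    - intros [p|] [q|] [r|]; rewrite <- ?Hidx;
        try (pose proof (Hlip (idx p) (idx q))); try (pose proof (Hadd (idx p) (idx r)));
        try (pose proof (Hlip (idx r) (idx q))); try (pose proof (Hf (idx p)));
        try (pose proof (Hf (idx q))); rewrite ?(Hs (x (idx r))) in *; auto; lra. }
  destruct (Huniv (option S) dS HdS) as [j Hj].
  { apply metric_weight_le; [exact HdS|].
    apply card_le_prod_M; auto; [|exact (proj1 Hunc)].
    apply card_le_option_M; auto; apply card_le_trans with J; [exact HS|exact (proj1 HJ)]. }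
  (* Off the range [F] takes a default value; only its restriction to the range is extended. *)
  set (F := fun y => match excluded_middle_informative (exists i, x i = y) with
    | left H => j (Some (exist _ y H)) | right _ => y end).
  assert (HF : forall i, exists p : S, proj1_sig p = x i /\ F (x i) = j (Some p)).
  { intros i; unfold F; destruct (excluded_middle_informative _) as [H|N].
    - exists (exist _ (x i) H); split; reflexivity.
    - destruct N; exists i; reflexivity. }
  destruct (Hhom (fun y => exists i, x i = y) F) as [h [[Hh Hsurj] Hext]].
  { exact (card_le_lt_trans _ _ _ HS HJ). }
  { intros y z [i <-] [k <-].
    destruct (HF i) as [p [Ep ->]], (HF k) as [q [Eq ->]]; rewrite Hj; simpl; congruence. }
  destruct (Hsurj (j None)) as [x' Hx']; exists x'; intros i.
  rewrite <- Hh, Hx', Hext by eauto.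
  destruct (HF i) as [p [Ep ->]]; rewrite Hj; simpl.
  (* The chosen index may differ from [i], but the points agree, so the Lipschitz inequality makes
     the values of [f] agree. *)
  assert (E : d (x (idx p)) (x i) = 0) by (apply H0; congruence).
  pose proof (Hlip (idx p) i); pose proof (Hlip i (idx p)).
  rewrite (Hs (x i)) in *; lra.
Qed.

(** * Back and forth *)

Section BackAndForth.

Variables (M : Type) (lt : M -> M -> Prop).
Hypotheses (Hwf : well_founded lt) (Htot : forall a b, lt a b \/ a = b \/ lt b a).
Variables (S X : Type) (D : S -> S -> R) (d : X -> X -> R).
Hypotheses (D0 : forall s, D s s = 0) (Dsym : forall s t, D s t = D t s).
Hypotheses (d0 : forall x, d x x = 0) (dsym : forall x y, d x y = d y x).

Definition partial_iso (J : Type) (s : J -> S) (x : J -> X) : Prop :=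
  forall i j, D (s i) (s j) = d (x i) (x j).

Hypothesis forth : forall a (s : option {b | lt b a} -> S) x, partial_iso _ s x ->
  forall t, exists y, forall i, D (s i) t = d (x i) y.
Hypothesis back : forall a (s : option {b | lt b a} -> S) x, partial_iso _ s x ->
  forall y, exists t, forall i, D (s i) t = d (x i) y.

(** By recursion along [lt], stage [a] adds a pair compatible with all earlier ones and having [z a]
    as a coordinate. Since [z] is onto the sum, both projections are onto. *)
Lemma back_and_forth (s0 : S) (x0 : X) (z : M -> S + X) :
  (forall w, exists a, z a = w) ->
  exists (s : M -> S) (x : M -> X), partial_iso M s x /\
    (forall t, exists a, s a = t) /\ (forall y, exists a, x a = y).
Proof.
  intros Hz.
  (* [None] indexes the starting pair, which keeps the index set inhabited even at the least
     stage. *)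
  pose (prev a (F : forall b, lt b a -> S * X) := fun o : option {b | lt b a} =>
    match o with None => (s0, x0) | Some b => F (proj1_sig b) (proj2_sig b) end).
  pose (good a (F : forall b, lt b a -> S * X) p :=
    (forall i, D (fst (prev a F i)) (fst p) = d (snd (prev a F i)) (snd p)) /\
    match z a with inl t => fst p = t | inr y => snd p = y end).
  pose (P := Fix Hwf (fun _ => (S * X)%type)
    (fun a F => epsilon (inhabits (s0, x0)) (good a F))).
  pose (PP a := fun b (_ : lt b a) => P b).
  assert (HP : forall a, P a = epsilon (inhabits (s0, x0)) (good a (PP a))).
  { intros a; unfold P at 1; rewrite Fix_eq; [reflexivity|].
    intros b F F' E; f_equal; f_equal.
    apply functional_extensionality_dep; intros c.
    apply functional_extensionality_dep; intros L; apply E. }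
  assert (Hgood : forall a, good a (PP a) (P a)).
  { intros a; induction a as [a IH] using (well_founded_ind Hwf).
    rewrite HP; apply epsilon_spec.
    assert (HI : partial_iso _ (fun i => fst (prev a (PP a) i)) (fun i => snd (prev a (PP a) i))).
    { intros [[b Lb]|] [[c Lc]|]; simpl; unfold PP.
      - destruct (Htot b c) as [L|[->|L]].
        + exact (proj1 (IH c Lc) (Some (exist _ b L))).
        + rewrite D0, d0; reflexivity.
        + rewrite Dsym, dsym; exact (proj1 (IH b Lb) (Some (exist _ c L))).
      - rewrite Dsym, dsym; exact (proj1 (IH b Lb) None).
      - exact (proj1 (IH c Lc) None).
      - rewrite D0, d0; reflexivity. }
    unfold good; destruct (z a) as [t|y].
    - destruct (forth a _ _ HI t) as [y Hy]; exists (t, y); auto.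
    - destruct (back a _ _ HI y) as [t Ht]; exists (t, y); auto. }
  exists (fun a => fst (P a)), (fun a => snd (P a)); split; [|split].
  - intros b c; destruct (Htot b c) as [L|[->|L]].
    + exact (proj1 (Hgood c) (Some (exist _ b L))).
    + rewrite D0, d0; reflexivity.
    + rewrite Dsym, dsym; exact (proj1 (Hgood b) (Some (exist _ c L))).
  - intros t; destruct (Hz (inl t)) as [a E]; exists a.
    pose proof (proj2 (Hgood a)) as H; rewrite E in H; exact H.
  - intros y; destruct (Hz (inr y)) as [a E]; exists a.
    pose proof (proj2 (Hgood a)) as H; rewrite E in H; exact H.
Qed.

End BackAndForth.

(** * Topological groups *)

Lemma open_local (X : Type) (op : (X -> Prop) -> Prop) (V : X -> Prop) :
  is_topology op ->
  (forall x, V x -> exists U, op U /\ U x /\ forall y, U y -> V y) -> op V.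
Proof.
  intros (_ & _ & HU) H.
  pose (I := {U : X -> Prop | op U /\ forall y, U y -> V y}).
  replace V with (fun x => exists i : I, proj1_sig i x).
  - apply HU; intros i; apply (proj2_sig i).
  - apply functional_extensionality; intros x; apply propositional_extensionality; split.
    + intros [i Hi]; exact (proj2 (proj2_sig i) x Hi).
    + intros Vx; destruct (H x Vx) as (U & H1 & H2 & H3); exists (exist _ U (conj H1 H3)); exact H2.
Qed.

Section PGroup.

Variables (M G : Type) (mul : G -> G -> G) (inv : G -> G) (e : G) (op : (G -> Prop) -> Prop).
Hypotheses (Hunc : uncountable M) (Hpow : sup_pow_below_eq M).
Hypotheses (HG : is_topological_group mul inv e op) (HP : is_P_space op M).

Lemma inv_mul_cancel a b : mul (inv a) (mul a b) = b.
Proof.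
  destruct HG as [(Ha & H1 & _ & H2 & _) _]; rewrite Ha, H2, H1; reflexivity.
Qed.

Lemma mul_inv_cancel a b : mul a (mul (inv a) b) = b.
Proof.
  destruct HG as [(Ha & H1 & _ & _ & H2) _]; rewrite Ha, H2, H1; reflexivity.
Qed.

Lemma inv_unique a b : mul a b = e -> b = inv a.
Proof.
  destruct HG as [(_ & _ & H1 & _ & _) _]; intros E.
  rewrite <- (inv_mul_cancel a b), E, H1; reflexivity.
Qed.

Lemma inv_mul a b : inv (mul a b) = mul (inv b) (inv a).
Proof.
  pose proof HG as [(Ha & _ & _ & _ & H2) _]; symmetry; apply inv_unique.
  rewrite <- Ha, mul_inv_cancel; apply H2.
Qed.

Lemma open_translate U g : op U -> op (fun x => U (mul g x)).
Proof.
  intros HU; destruct HG as (_ & HT & _ & Hm & _).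
  apply open_local; [exact HT|]; intros x Ux.
  destruct (Hm U g x HU Ux) as (V & W & _ & HW & Vg & Wx & K).
  exists W; auto.
Qed.

(** Starting from [U], choose neighbourhoods of [e] such that quotients of elements of each lie in
    the previous one. Their intersection is a subgroup, and it is open because [nat] is smaller than
    [M]. *)
Lemma open_subgroup_inside U : op U -> U e -> exists H : G -> Prop,
  op H /\ H e /\ (forall a b, H a -> H b -> H (mul (inv a) b)) /\ (forall x, H x -> U x).
Proof.
  intros HU Ue; pose proof HG as ((_ & H1 & _ & H2 & _) & HT & _ & Hm & Hi).
  assert (inv_e : inv e = e) by (symmetry; apply inv_unique, H1).
  pose (N := {V : G -> Prop | op V /\ V e}).
  assert (Hstep : forall V : N, exists W : N, forall a b,
    proj1_sig W a -> proj1_sig W b -> proj1_sig V (mul (inv a) b)).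
  { intros [V [HV Ve]]; simpl.
    destruct (Hm V (inv e) e HV) as (V1 & V2 & O1 & O2 & E1 & E2 & K).
    { rewrite inv_e, H1; exact Ve. }
    destruct (Hi V1 e O1 E1) as (V3 & O3 & E3 & K3).
    unshelve eexists (exist _ (fun x => V3 x /\ V2 x) _).
    - split; [apply HT; assumption | split; assumption].
    - simpl; intros a b [A1 A2] [B1 B2]; apply K; auto. }
  destruct (choice _ _ _ Hstep) as [nxt Hnxt].
  pose (V := fix V n := match n with O => exist _ U (conj HU Ue) : N | S n => nxt (V n) end).
  exists (fun x => forall n, proj1_sig (V n) x); split; [|split; [|split]].
  - apply (HP nat (fun n => proj1_sig (V n)) Hunc); intros n; apply (proj2_sig (V n)).
  - intros n; apply (proj2_sig (V n)).
  - intros a b Ka Kb n; apply (Hnxt (V n)); [apply (Ka (S n)) | apply (Kb (S n))].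
  - intros x K; exact (K 0%nat).
Qed.

(* The disjoint union of the coset spaces of a base of open subgroups; it has at
   most [M] points since disjoint cosets contain distinct basic open sets. *)
Lemma separating_G_set (I : Type) (B : I -> G -> Prop) : is_base op I B -> card_le I M ->
  exists (Y : Type) (k : G -> Y -> Y), inhabited Y /\ card_le Y M /\
    (forall g h y, k (mul g h) y = k g (k h y)) /\ (forall y, k e y = y) /\
    (forall y, exists U, op U /\ U e /\ forall g, U g -> k g y = y) /\
    (forall V g, op V -> V g -> exists y, forall h, k h y = k g y -> V h).
Proof.
  intros [HB1 HB2] HI.
  pose proof HG as ((Ha & H1l & H1r & Hil & Hir) & HT & _).
  assert (Hsub : forall i : {i | B i e}, exists H : G -> Prop,
    op H /\ H e /\ (forall a b, H a -> H b -> H (mul (inv a) b)) /\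
    (forall x, H x -> B (proj1_sig i) x)).
  { intros [i Hi]; exact (open_subgroup_inside (B i) (HB1 i) Hi). }
  destruct (choice _ _ _ Hsub) as [H HH]; clear Hsub.
  pose (coset i g := fun x => H i (mul (inv g) x)).
  assert (coset_self : forall i g, coset i g g).
  { intros i g; unfold coset; rewrite Hil; apply HH. }
  assert (coset_sub : forall i g g' x, coset i g g' -> coset i g x -> coset i g' x).
  { unfold coset; intros i g g' x K1 K2.
    pose proof (proj1 (proj2 (proj2 (HH i))) _ _ K1 K2) as K3.
    rewrite inv_mul, <- Ha in K3.
    replace (inv (inv g)) with g in K3 by (apply inv_unique, Hil).
    rewrite mul_inv_cancel in K3; exact K3. }
  assert (coset_mem_sym : forall i g g', coset i g g' -> coset i g' g).
  { intros i g g' K; exact (coset_sub i g g' g K (coset_self i g)). }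
  assert (coset_eq : forall i g g', coset i g g' -> coset i g = coset i g').
  { intros i g g' K; apply functional_extensionality; intros x.
    apply propositional_extensionality; split; apply coset_sub; auto. }
  assert (coset_shift : forall i g h, (fun x => coset i h (mul (inv g) x)) = coset i (mul g h)).
  { intros i g h; unfold coset; apply functional_extensionality; intros x.
    rewrite inv_mul, <- Ha; reflexivity. }
  pose (Y := {c : G -> Prop | exists i g, c = coset i g}).
  assert (Hk : forall (g : G) (c : Y), exists i h, (fun x => proj1_sig c (mul (inv g) x)) = coset i h).
  { intros g [c (i & h & ->)]; exists i, (mul g h); apply coset_shift. }
  pose (k g (c : Y) := exist _ (fun x => proj1_sig c (mul (inv g) x)) (Hk g c) : Y).
  pose (mk i g := exist _ (coset i g) (ex_intro _ i (ex_intro _ g eq_refl)) : Y).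
  assert (k_mk : forall g i h, k g (mk i h) = mk i (mul g h)).
  { intros; apply sig_eq; apply coset_shift. }
  assert (Y_mk : forall c, exists i g, c = mk i g).
  { intros [c (i & g & ->)]; exists i, g; apply sig_eq; reflexivity. }
  exists Y, k; split; [|split; [|split; [|split; [|split]]]].
  - destruct (HB2 (fun _ => True) e (proj1 HT) Logic.I) as [i [Hi _]].
    constructor; exact (mk (exist _ i Hi) e).
  - apply card_le_trans with (I * I)%type; [|apply card_le_prod_M; auto].
    assert (Hc : forall c : Y, exists p : I * I, exists i g,
      proj1_sig i = fst p /\ c = mk i g /\ B (snd p) g /\ forall x, B (snd p) x -> coset i g x).
    { intros c; destruct (Y_mk c) as (i & g & ->).
      destruct (HB2 (coset i g) g) as [j [Hj Hj']];
        [apply open_translate, HH | apply coset_self|].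
      exists (proj1_sig i, j), i, g; auto. }
    destruct (choice _ _ _ Hc) as [p Hp]; exists p; intros c c' E.
    destruct (Hp c) as (i & g & E1 & -> & K1 & K2), (Hp c') as (i' & g' & E1' & -> & K1' & K2').
    rewrite E in *.
    assert (i = i') as -> by (apply sig_eq; congruence).
    apply sig_eq, coset_eq, K2, K1'.
  - intros g h y; apply sig_eq; simpl; apply functional_extensionality; intros x.
    rewrite inv_mul, Ha; reflexivity.
  - intros y; apply sig_eq; simpl; apply functional_extensionality; intros x.
    replace (inv e) with e by apply inv_unique, H1l; rewrite H1l; reflexivity.
  - intros y; destruct (Y_mk y) as (i & g & ->).
    (* The elements that keep [g] in its own coset fix that coset; they form the preimage of an open
       set under right translation. *)
    assert (HO : op (fun x => coset i g (mul x g))).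
    { apply open_local; [exact HT|]; intros x Hx.
      destruct HG as (_ & _ & _ & Hm & _).
      destruct (Hm (coset i g) x g) as (V & W & HV & _ & Vx & Wg & K);
        [apply open_translate, HH | exact Hx|].
      exists V; auto. }
    exists (fun x => coset i g (mul x g)); split; [exact HO|split].
    + rewrite H1l; apply coset_self.
    + intros h Hh; rewrite k_mk; apply sig_eq; symmetry; apply coset_eq, Hh.
  - intros V g HV Vg.
    (* The separating point is a subgroup [H i] with [g H i] inside [V]: an [h] that moves it as [g]
       does lies in [g H i]. *)
    destruct (HB2 (fun x => V (mul g x)) e) as [j [Hj Hj']];
      [apply open_translate, HV | rewrite H1r; exact Vg|].
    pose (i := exist (fun i => B i e) j Hj).
    exists (mk i e); intros h E; rewrite !k_mk, !H1r in E.
    apply (f_equal (@proj1_sig _ _)) in E; simpl in E.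
    assert (K : coset i g h) by (rewrite <- E; apply coset_self).
    apply HH, Hj' in K; rewrite mul_inv_cancel in K; exact K.
Qed.

End PGroup.

(** * The embedding *)

Lemma term_stabilizer (M : Type) (Ar : M -> Type) (Y G : Type) (e : G)
  (op : (G -> Prop) -> Prop) (k : G -> Y -> Y) :
  is_P_space op M -> (forall a, card_lt (Ar a) M) ->
  (forall y, exists U, op U /\ U e /\ forall g, U g -> k g y = y) ->
  forall t : term M Ar Y, exists U, op U /\ U e /\ forall g, U g -> tmap (k g) t = t.
Proof.
  intros HP HAr Hk t; induction t as [y|a A IH f]; simpl.
  - destruct (Hk y) as (U & H1 & H2 & H3); exists U; split; [|split]; auto.
    intros g Ug; rewrite H3; auto.
  - destruct (choice _ _ _ IH) as [U HU].
    exists (fun g => forall i, U i g); split; [|split].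
    + apply (HP _ U (HAr a)); intros i; apply HU.
    + intros i; apply HU.
    + intros g Ug; f_equal; apply functional_extensionality; intros i; apply HU, Ug.
Qed.

(** The arity [option {b | lt b a}] indexes exactly the pairs available at stage [a], so the back
    step is answered by one node labelled [a], the forth step by [one_point_extension]. Since
    [kdist] is only a pseudometric, the outcome is a surjection [Phi] with a section [psi]. *)
Lemma terms_onto_urysohn (M : Type) (lt : M -> M -> Prop) (Y X : Type) (d : X -> X -> R) :
  uncountable M -> sup_pow_below_eq M -> well_founded lt ->
  (forall a b, lt a b \/ a = b \/ lt b a) -> (forall a, card_lt {b | lt b a} M) ->
  inhabited Y -> card_le Y M -> Urysohn_Katetov d M ->
  let S := {t : term M (fun a => option {b | lt b a}) Y | valid t} in
  exists (Phi : S -> X) (psi : X -> S),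
    (forall s t, d (Phi s) (Phi t) = kdist (proj1_sig s) (proj1_sig t)) /\
    (forall x, Phi (psi x) = x).
Proof.
  intros Hunc Hpow Hwf Htot Hseg [y0] HY (Hd & _ & [[E [HE HEM]] _] & Huniv & Hhom) S.
  pose proof Hd as (Hp & H0 & Hs & Ht).
  assert (HAr : forall a, card_lt (option {b | lt b a}) M) by (intros; apply card_lt_option; auto).
  assert (Hinh : forall a, inhabited (option {b | lt b a})) by (intros; exact (inhabits None)).
  pose (D := fun s t : S => kdist (proj1_sig s) (proj1_sig t)).
  destruct HEM as [c [Hc Hc']].
  destruct (uncountable_two M Hunc) as [m0 _]; destruct (Hc' m0) as [[x0 _] _].
  assert (HX : card_le X M).
  { apply (dense_card X M d E); auto; exists c; exact Hc. }
  assert (HS : card_le S M).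
  { apply card_le_trans with (term M (fun a => option {b | lt b a}) Y);
      [|apply term_card; auto].
    exists (@proj1_sig _ _); intros s t; apply sig_eq. }
  pose (s0 := exist _ (leaf y0) I : S).
  destruct (surj_of_card_le (S + X) M (inl s0)) as [z Hz]; [apply card_le_sum_M; auto|].
  assert (D0 : forall t, D t t = 0) by (intros; apply kdist_refl; exact Hinh).
  assert (Dsym : forall t u, D t u = D u t) by (intros; apply kdist_sym; exact Hinh).
  assert (Dtri : forall t u v, D t v <= D t u + D u v)
    by (intros t u v; apply kdist_triangle; [exact Hinh | exact (proj2_sig u)]).
  assert (d0 : forall x, d x x = 0) by (intros; apply H0; reflexivity).
  assert (forth : forall a (s : option {b | lt b a} -> S) x, partial_iso S X D d _ s x ->
    forall t, exists y, forall i, D (s i) t = d (x i) y).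
  { intros a s x HI t.
    destruct (one_point_extension X M d Hunc Hpow Hd Huniv Hhom
      (option {b | lt b a}) x (fun i => D (s i) t)) as [y Hy]; auto.
    - intros i j; rewrite <- HI, Rplus_comm; apply Dtri.
    - intros i j; rewrite <- HI, (Dsym (s j)); apply Dtri.
    - exists y; intros i; symmetry; apply Hy. }
  assert (back : forall a (s : option {b | lt b a} -> S) x, partial_iso S X D d _ s x ->
    forall y, exists t, forall i, D (s i) t = d (x i) y).
  { intros a s x HI y.
    assert (V : valid (node (Ar := fun a => option {b | lt b a}) a
      (fun i => proj1_sig (s i)) (fun i => d (x i) y))).
    { simpl; split; [intros i; exact (proj2_sig (s i))|]; intros i j.
      pose proof (HI i j) as E'; unfold D in E'; rewrite E'.
      rewrite !Rabs_pos_eq by auto.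
      pose proof (Ht (x i) (x j) y); pose proof (Ht (x i) y (x j)).
      rewrite (Hs y) in *; lra. }
    exists (exist _ _ V : S); intros i; unfold D; simpl.
    rewrite (kdist_node _ _ _ Hinh a (fun i => proj1_sig (s i)) (fun i => d (x i) y) i V).
    apply Rabs_pos_eq, Hp. }
  destruct (back_and_forth M lt Hwf Htot S X D d D0 Dsym d0 Hs forth back s0 x0 z Hz)
    as (s & x & HI & Hsurj & Hxurj).
  destruct (choice _ _ _ Hsurj) as [ia Hia], (choice _ _ _ Hxurj) as [ib Hib].
  exists (fun t => x (ia t)), (fun y => s (ib y)); split.
  - intros t u; rewrite <- HI, !Hia; reflexivity.
  (* The index that [ia] picks for the term [s (ib y)] may differ from [ib y], but the two points of
     [X] are at distance 0. *)
  - intros y; rewrite <- (Hib y) at 2; apply H0.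
    rewrite <- HI, Hia; apply D0.
Qed.

Theorem theorem4p6p7 (M : Type) (G : Type) (mul : G -> G -> G) (inv : G -> G) (e : G)
  (op : (G -> Prop) -> Prop) :
  uncountable M -> sup_pow_below_eq M ->
  is_topological_group mul inv e op -> is_P_space op M -> weight_is op M ->
  forall (X : Type) (d : X -> X -> R), Urysohn_Katetov d M ->
  exists phi : G -> X -> X, embeds_into_Iso mul op d phi.
Proof.
  intros Hunc Hpow HG HP [(I & B & HB & [c [Hc _]]) _] X d HX.
  pose proof HG as ((_ & H1l & H1r & Hil & Hir) & HT & Hhaus & _).
  destruct (separating_G_set M G mul inv e op Hunc Hpow HG HP I B HB)
    as (Y & k & HY & HYM & kmul & k1 & kstab & ksep); [exists c; exact Hc|].
  destruct (initial_order_exists M) as (lt & Hwf & Htot & Hseg).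
  destruct (terms_onto_urysohn M lt Y X d Hunc Hpow Hwf Htot Hseg HY HYM HX)
    as (Phi & psi & HPhi & Hpsi).
  destruct HX as ((Hp & H0 & Hs & Ht) & _).
  set (Ar := fun a => option {b | lt b a}) in *.
  set (S := {t : term M Ar Y | valid t}) in *.
  assert (Hinh : forall a, inhabited (Ar a)) by (intros; exact (inhabits None)).
  assert (kinv : forall g y, k (inv g) (k g y) = y) by (intros; rewrite <- kmul, Hil; auto).
  pose (act g (s : S) := exist _ (tmap (k g) (proj1_sig s))
    (valid_tmap M Ar Y Hinh (k g) (k (inv g)) _ (kinv g) (proj2_sig s)) : S).
  assert (act_dist : forall g s t, d (Phi (act g s)) (Phi (act g t)) = d (Phi s) (Phi t)).
  { intros; rewrite !HPhi; exact (kdist_tmap M Ar Y Hinh (k g) (k (inv g)) _ _ (kinv g)). }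
  (* Terms with the same image are at distance 0 and stay so under the action, which therefore
     passes to [X]. *)
  assert (act_eq : forall g s t, Phi s = Phi t -> Phi (act g s) = Phi (act g t)).
  { intros g s t E; apply H0; rewrite act_dist; apply H0, E. }
  assert (act_mul : forall g h s, act (mul g h) s = act g (act h s)).
  { intros; apply sig_eq, tmap_comp; apply kmul. }
  assert (act_1 : forall s, act e s = s).
  { intros; apply sig_eq, tmap_id; apply k1. }
  assert (act_stab : forall s, exists U, op U /\ U e /\ forall g, U g -> act g s = s).
  { intros s; destruct (term_stabilizer M Ar Y G e op k HP) with (t := proj1_sig s)
      as (U & O & Ue & HU); auto.
    - intros; apply card_lt_option; auto.
    - exists U; split; [exact O|split; [exact Ue|]]; intros; apply sig_eq, HU; assumption. }
  pose (phi g x := Phi (act g (psi x))).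
  assert (phi_Phi : forall g s, phi g (Phi s) = Phi (act g s)).
  { intros g s; apply act_eq, Hpsi. }
  assert (phi_mul : forall g h x, phi (mul g h) x = phi g (phi h x)).
  { intros g h x; unfold phi at 1 3; rewrite act_mul, phi_Phi; reflexivity. }
  assert (Hopen : forall V, op V -> exists O, iso_open d O /\ forall g, V g <-> O (phi g)).
  { intros V HV.
    pose (sep g (x : X) := forall h, d (phi h x) (phi g x) < / 2 -> V h).
    assert (Hsep : forall g, V g -> exists x, sep g x).
    { intros g Vg; destruct (ksep V g HV Vg) as [y Hy].
      (* Distinct leaves are at least 1 apart, so agreement within 1/2 at the leaf [y] means that
         [h] and [g] move [y] alike. *)
      exists (Phi (exist _ (leaf y) Logic.I)); intros h Hh.
      rewrite !phi_Phi, HPhi in Hh; apply Hy.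
      apply (kdist_leaf_lt_1 M Ar Y Hinh); simpl in Hh; lra. }
    exists (fun f => exists g x, V g /\ sep g x /\ d (f x) (phi g x) < / 2); split.
    - intros f Hf (g & x & Vg & Hx & Hlt).
      exists (x :: nil), (/ 2 - d (f x) (phi g x)); split; [lra|].
      intros h Hh Hl; exists g, x; split; [exact Vg|split; [exact Hx|]].
      specialize (Hl x (or_introl eq_refl)).
      pose proof (Ht (h x) (f x) (phi g x)); lra.
    - intros g; split.
      + intros Vg; destruct (Hsep g Vg) as [x Hx]; exists g, x; split; [exact Vg|split; [exact Hx|]].
        rewrite (proj2 (H0 _ _) eq_refl); lra.
      + intros (h & x & Vh & Hx & Hlt); exact (Hx g Hlt). }
  assert (Hiso : forall g, is_isometry d (phi g)).
  { intros g; split.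
    - intros x y; unfold phi; rewrite act_dist, !Hpsi; reflexivity.
    - intros y; exists (phi (inv g) y); rewrite <- phi_mul, Hir; unfold phi.
      rewrite act_1; apply Hpsi. }
  assert (Hfix : forall l, exists U, op U /\ U e /\
    forall g, U g -> forall x, In x l -> phi g x = x).
  { induction l as [|x l (U & HU & Ue & KU)].
    - exists (fun _ => True); split; [apply HT|split; [exact Logic.I|]]; intros g _ x [].
    - destruct (act_stab (psi x)) as (W & HW & We & KW).
      exists (fun g => W g /\ U g); split; [apply HT; assumption|split; [split; assumption|]].
      intros g [Wg Ug] y [<-|Hy]; [unfold phi; rewrite KW; auto | exact (KU g Ug y Hy)]. }
  exists phi; split; [exact Hiso|split; [exact phi_mul|split; [|split; [|exact Hopen]]]].
  (* Every open set of the group is a preimage under [phi], so the Hausdorff property gives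
     injectivity. *)
  - intros g h E; apply NNPP; intros N.
    destruct (Hhaus g h N) as (U & V & HU & HV & Ug & Vh & Hdisj).
    destruct (Hopen U HU) as (O & _ & HO); apply (Hdisj h); [|exact Vh].
    apply HO; replace (phi h) with (phi g); [apply HO, Ug|].
    apply functional_extensionality; exact E.
  - intros O HO; apply open_local; [exact HT|]; intros g Og.
    destruct (HO (phi g) (Hiso g) Og) as (l & eps & Heps & Hl).
    destruct (Hfix l) as (U & HU & Ue & KU).
    (* On the left translate of [U] by [g], all [phi h] agree exactly with [phi g] at the points of
       [l]. *)
    exists (fun h => U (mul (inv g) h)); split; [|split].
    + exact (open_translate G mul inv e op HG U (inv g) HU).
    + rewrite Hil; exact Ue.
    + intros h Uh; apply Hl; [apply Hiso|]; intros x Hx.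
      rewrite <- (mul_inv_cancel G mul inv e op HG g h), phi_mul, (KU _ Uh x Hx).
      rewrite (proj2 (H0 _ _) eq_refl); exact Heps.
Qed.
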